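(* Let $G$ be a finite simple connected graph with at least one edge, with maximum degree $\Delta$ and minimum degree $\delta$. Then $$\frac{4\Delta^2\delta^2\sqrt{2\delta M_1(G)R_{-1}(G)}}{(\Delta^2+\delta^2)(\delta+\Delta)^2}\le GA_1(G)\le \frac{\sqrt{2\Delta M_1(G)R_{-1}(G)}}{2},$$ and each of the two equalities holds if and only if $G$ is a regular graph.
   Context: For a graph $G$ with vertex set $V(G)$ and edge set $E(G)$, $d_u$ denotes the degree of the vertex $u$. The first geometric-arithmetic index is $GA_1(G)=\sum_{uv\in E(G)}\frac{2\sqrt{d_ud_v}}{d_u+d_v}$. The first Zagreb index is $M_1(G)=\sum_{u\in V(G)} d_u^2$. Also $R_{-1}(G)=\sum_{uv\in E(G)}\frac{1}{d_ud_v}$ (the general Randić index $R_\alpha(G)=\sum_{uv\in E(G)}(d_ud_v)^\alpha$ with $\alpha=-1$). *)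

(* Defs.v *)
From HB Require Import structures.
From mathcomp Require Import all_boot all_order all_algebra.

Set Implicit Arguments.
Unset Strict Implicit.
Unset Printing Implicit Defensive.

Import Order.TTheory GRing.Theory Num.Theory.

Record sgraph := SGraph {
  svertex :> finType;
  sedge : rel svertex;
  sedge_sym : symmetric sedge;
  sedge_irrefl : irreflexive sedge
}.

Section Indices.

Variable G : sgraph.

Definition edges : {set {set G}} :=
  [set e : {set G} | [exists u, exists v, sedge u v && (e == [set u; v])]].

Definition connected : Prop := forall u v : G, connect (@sedge G) u v.

Definition deg (u : G) : nat := #|[set v | sedge u v]|.

Definition max_deg : nat := \max_(u : G) deg u.

(* Every degree is at most [#|G|], so the default value only matters when [G]
   has no vertex. *)
Definition min_deg : nat := \big[minn/#|G|]_(u : G) deg u.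

Definition regular : Prop := exists k : nat, forall u : G, deg u = k.

(* An edge [e] is the two-element set of its endpoints [u] and [v], so
   [deg_prod e] is d_u * d_v and [deg_sum e] is d_u + d_v. *)
Definition deg_prod (e : {set G}) : nat := \prod_(w in e) deg w.
Definition deg_sum (e : {set G}) : nat := \sum_(w in e) deg w.

(* First Zagreb index. *)
Definition M1 : nat := \sum_(u : G) deg u ^ 2.

Local Open Scope ring_scope.

(* First geometric-arithmetic index. *)
Definition GA1 (R : rcfType) : R :=
  \sum_(e in edges) 2 * Num.sqrt (deg_prod e)%:R / (deg_sum e)%:R.

(* General Randic index with exponent -1. *)
Definition randic_m1 (R : rcfType) : R :=
  \sum_(e in edges) 1 / (deg_prod e)%:R.

End Indices.

(* Main.v *)
(* Write q^2 = d_u d_v and s = d_u + d_v for an edge uv, so that GA_1 sums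
    2q/s, R_{-1} sums 1/q^2 and, by double counting, M_1 sums s.

    Upper bound: (2q/s)^2 <= s * (Delta / (2 q^2)) edge by edge, with equality
    only if d_u = d_v = Delta, and Cauchy-Schwarz applies.

    Lower bound: edge by edge,
    1/q^2 + delta s / (2 Delta^2 delta^2) <= K * (2q/s) with
    K = (Delta^2 + delta^2) (Delta + delta)^2 / (4 Delta^3 delta^3),
    with equality only if q = delta; sum over the edges and apply AM-GM to the
    left-hand side. *)
Require Import Defs.
From HB Require Import structures.
From mathcomp Require Import all_boot all_order all_algebra.
From mathcomp Require Import ring lra.

Set Implicit Arguments.
Unset Strict Implicit.
Unset Printing Implicit Defensive.

Import Order.TTheory GRing.Theory Num.Theory.
Local Open Scope ring_scope.

(** * Degrees, incidence counting and connectivity *)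

Section Degrees.

Variable G : sgraph.

Lemma edgesP (e : {set G}) :
  reflect (exists u v, sedge u v /\ e = [set u; v]) (e \in edges G).
Proof.
rewrite inE; apply: (iffP existsP) => [[u /existsP[v /andP[uv /eqP ->]]]|].
  by exists u, v.
by case=> u [v [uv ->]]; exists u; apply/existsP; exists v; rewrite uv eqxx.
Qed.

Lemma sedge_neq (u v : G) : sedge u v -> u != v.
Proof. by apply: contraTneq => ->; rewrite sedge_irrefl. Qed.

Lemma deg_prod2 (u v : G) : u != v -> deg_prod [set u; v] = (deg u * deg v)%N.
Proof. by move=> uv; rewrite /deg_prod big_setU1 ?inE // big_set1. Qed.

Lemma deg_sum2 (u v : G) : u != v -> deg_sum [set u; v] = (deg u + deg v)%N.
Proof. by move=> uv; rewrite /deg_sum big_setU1 ?inE // big_set1. Qed.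

(** The map sending [v] to [[set w; v]] carries the neighbours of [w] onto the edges through [w]; it
    is injective there because no neighbour of [w] equals [w]. *)
Lemma card_incident_edges (w : G) : #|[set e in edges G | w \in e]| = deg w.
Proof.
rewrite /deg -(card_in_imset (f := fun v => [set w; v])); last first.
  move=> x y; rewrite !inE => wx wy eq_xy.
  have : x \in [set w; y] by rewrite -eq_xy set22.
  by rewrite !inE eq_sym (negPf (sedge_neq wx)) => /eqP.
apply: eq_card => e; rewrite !inE; apply/andP/imsetP.
  case=> /existsP[u /existsP[v /andP[uv /eqP ->]]].
  rewrite !inE => /orP[] /eqP ->; first by exists v; rewrite ?inE.
  by exists u; rewrite ?inE 1?sedge_sym // setUC.
case=> v; rewrite inE => wv ->; split; last by rewrite set21.
by apply/existsP; exists w; apply/existsP; exists v; rewrite wv eqxx.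
Qed.

(** Double counting: after exchanging the sums, each vertex [w] contributes [deg w] once for each of
    its [deg w] incident edges. *)
Lemma M1_edges : M1 G = \sum_(e in edges G) deg_sum e.
Proof.
rewrite /M1 /deg_sum (exchange_big_dep predT) //=; apply: eq_bigr => w _.
by rewrite sum_nat_cond_const card_incident_edges -mulnn.
Qed.

Lemma leq_max_deg (u : G) : (deg u <= max_deg G)%N.
Proof. exact: leq_bigmax. Qed.

Lemma geq_min_deg (u : G) : (min_deg G <= deg u)%N.
Proof.
rewrite /min_deg; elim: (index_enum G) (mem_index_enum u) => // w s IHs.
rewrite inE big_cons geq_min => /orP[/eqP -> | /IHs ->]; rewrite ?leqnn //.
exact: orbT.
Qed.

(** The bound by [#|G|] covers the default value of the iterated minimum. *)
Lemma min_deg_glb k :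
  (k <= #|G|)%N -> (forall u : G, (k <= deg u)%N) -> (k <= min_deg G)%N.
Proof.
move=> kG kdeg; rewrite /min_deg.
by elim/big_ind: _ => // x y kx ky; rewrite leq_min kx.
Qed.

Lemma edge_exists : edges G != set0 -> exists u v : G, sedge u v.
Proof. by case/set0Pn => e /edgesP[u [v [uv _]]]; exists u, v. Qed.

Hypothesis Gconn : connected G.
Hypothesis Gedge : edges G != set0.

(** Take a path from [w] to an endpoint of some edge: if it is empty, [w] is that endpoint;
    otherwise its first step leads to a neighbour. *)
Lemma exists_neighbour (w : G) : exists v, sedge w v.
Proof.
have [u [v uv]] := edge_exists Gedge.
have /connectP[[|x p] /= wp] := Gconn w u; first by move=> <-; exists v.
by case/andP: wp => wx _ _; exists x.
Qed.

Lemma deg_gt0 (w : G) : (0 < deg w)%N.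
Proof.
by have [v wv] := exists_neighbour w; apply/card_gt0P; exists v; rewrite inE.
Qed.

Lemma min_deg_gt0 : (0 < min_deg G)%N.
Proof.
have [u _] := edge_exists Gedge.
by apply: min_deg_glb deg_gt0; apply/card_gt0P; exists u.
Qed.

Lemma regular_min_max_deg k :
  (forall u : G, deg u = k) -> min_deg G = k /\ max_deg G = k.
Proof.
move=> degk; have [u _] := edge_exists Gedge.
split; apply/eqP; rewrite eqn_leq.
  rewrite -{1}(degk u) geq_min_deg /= min_deg_glb // => [|v]; last by rewrite degk.
  by rewrite -(degk u) max_card.
rewrite -{2}(degk u) leq_max_deg andbT.
by apply/bigmax_leqP => v _; rewrite degk.
Qed.

(** Serves the equality cases, where the edgewise estimates fix the degree of one endpoint of each
    oriented edge; every vertex occurs as such an endpoint. *)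
Lemma regular_of_edges k :
  (forall u v : G, sedge u v -> deg u = k) -> regular G.
Proof.
by move=> edgek; exists k => u; have [v /edgek] := exists_neighbour u.
Qed.

End Degrees.

(** * Real inequalities: Cauchy-Schwarz and the estimates for a single edge *)

Section Inequalities.

Variable R : rcfType.
Implicit Types (u v q s d D : R).

(** A form of Cauchy-Schwarz with its equality case. The quadratic form with coefficients [a i],
    [- 2 * g i], [b i] is nonnegative by the discriminant condition; [f i] is its value at [(S, A)],
    and these values sum to [A * (A * B - S ^+ 2)]. *)
Lemma sqr_sum_le (I : finType) (P : pred I) (a b g : I -> R) :
  (forall i, P i -> 0 < a i) ->
  (forall i, P i -> g i ^+ 2 <= a i * b i) ->
  let A := \sum_(i | P i) a i in
  let B := \sum_(i | P i) b i in
  let S := \sum_(i | P i) g i in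
  S ^+ 2 <= A * B /\
  (S ^+ 2 = A * B -> forall i, P i -> g i ^+ 2 = a i * b i).
Proof.
move=> a_gt0 g_le A B S.
pose f i := a i * S ^+ 2 - 2 * g i * S * A + b i * A ^+ 2.
have A_ge0 : 0 <= A by apply: sumr_ge0 => i /a_gt0/ltW.
have afE i : a i * f i = (a i * S - g i * A) ^+ 2 + (a i * b i - g i ^+ 2) * A ^+ 2.
  by rewrite /f; ring.
have f_ge0 i : P i -> 0 <= f i.
  move=> Pi; rewrite -(pmulr_rge0 _ (a_gt0 i Pi)) afE.
  by rewrite addr_ge0 ?sqr_ge0 // mulr_ge0 ?sqr_ge0 // subr_ge0 g_le.
have sum_f : \sum_(i | P i) f i = A * (A * B - S ^+ 2).
  rewrite !big_split /= sumrN -!mulr_suml -mulr_sumr -/A -/B -/S; ring.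
have [A0|A_neq0] := eqVneq A 0.
  (* A vanishing sum of positive terms has no terms at all. *)
  have noP i : P i -> False.
    move=> Pi; have := a_gt0 i Pi.
    by rewrite (psumr_eq0P _ A0) ?ltxx // => j /a_gt0/ltW.
  have S0 : S = 0 by apply: big1 => i /noP.
  by rewrite A0 S0 mul0r expr0n; split=> // _ i /noP.
have A_gt0 : 0 < A by rewrite lt_def A_neq0.
split.
  by rewrite -subr_ge0 -(pmulr_rge0 _ A_gt0) -sum_f sumr_ge0.
(* Equality makes every [f i] zero, so both nonnegative summands in [afE] vanish; the second one
   gives the claim since [A] is nonzero. *)
move=> SAB i Pi; have /psumr_eq0P f0 : \sum_(i | P i) f i = 0.
  by rewrite sum_f SAB subrr mulr0.
have /eqP := afE i; rewrite f0 // mulr0 eq_sym paddr_eq0 ?sqr_ge0 //; last first.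
  by rewrite mulr_ge0 ?sqr_ge0 // subr_ge0 g_le.
case/andP=> _; rewrite mulf_eq0 expf_eq0 (negPf A_neq0) andbF orbF subr_eq0.
by move/eqP.
Qed.

Lemma sqrt_mul2_le_add u v : 0 <= u -> 0 <= v -> 2 * Num.sqrt (u * v) <= u + v.
Proof.
move=> u0 v0; rewrite sqrtrM //.
have := sqr_ge0 (Num.sqrt u - Num.sqrt v).
by rewrite sqrrB !sqr_sqrtr //; lra.
Qed.

Lemma double_sqrt_le_add u v q :
  0 <= q -> 0 <= u -> 0 <= v -> q ^+ 2 = u * v -> 2 * q <= u + v.
Proof.
move=> q0 u0 v0 q2; rewrite -(ler_pXn2r (ltn0Sn 1)) ?nnegrE; try lra.
have := sqr_ge0 (u - v); nra.
Qed.

(** Over a common denominator the difference splits into a part that is nonnegative by [s <= 2 * D]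
    and a part that is nonnegative by [2 * q <= s]. Equality kills the first part, so
    [u + v = 2 * D]. *)
Lemma GA_term_sqr_le u v q D :
  0 < q -> 0 < u <= D -> 0 < v <= D -> q ^+ 2 = u * v ->
  (2 * q / (u + v)) ^+ 2 <= (u + v) * (D / 2 / q ^+ 2)
  /\ ((2 * q / (u + v)) ^+ 2 = (u + v) * (D / 2 / q ^+ 2) -> u = D).
Proof.
move=> q0 /andP[u0 uD] /andP[v0 vD] q2.
have s2q := double_sqrt_le_add (ltW q0) (ltW u0) (ltW v0) q2.
set s := u + v in s2q *.
have s0 : 0 < s by rewrite addr_gt0.
have s4 : 16 * q ^+ 4 <= s ^+ 4.
  have -> : 16 * q ^+ 4 = (2 * q) ^+ 4 by ring.
  by rewrite lerXn2r ?nnegrE; lra.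
have diffE : s * (D / 2 / q ^+ 2) - (2 * q / s) ^+ 2
    = (s ^+ 3 * (2 * D - s) + (s ^+ 4 - 16 * q ^+ 4))
      / (4 * q ^+ 2 * s ^+ 2) .
  by field; rewrite !gt_eqF.
have s3 : 0 < s ^+ 3 by rewrite exprn_gt0.
have den0 : 0 < 4 * q ^+ 2 * s ^+ 2 by rewrite !mulr_gt0 ?exprn_gt0.
have sD : 0 <= s ^+ 3 * (2 * D - s) by rewrite mulr_ge0 ?(ltW s3) // /s; lra.
split; first by rewrite -subr_ge0 diffE divr_ge0 ?(ltW den0) //; lra.
move/eqP; rewrite eq_sym -subr_eq0 diffE mulf_eq0 invr_eq0 (gt_eqF den0) orbF.
rewrite paddr_eq0 //; last by lra.
by case/andP; rewrite mulf_eq0 (gt_eqF s3) /= /s => /eqP; lra.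
Qed.

Lemma GA_term_ge u v q d D :
  0 < d -> 0 < q -> d <= u <= D -> d <= v <= D -> q ^+ 2 = u * v ->
  let K := (D ^+ 2 + d ^+ 2) * (d + D) ^+ 2 / (4 * D ^+ 3 * d ^+ 3) in
  let a := d / (2 * D ^+ 2 * d ^+ 2) in
  1 / q ^+ 2 + a * (u + v) <= K * (2 * q / (u + v))
  /\ (1 / q ^+ 2 + a * (u + v) = K * (2 * q / (u + v)) -> u = d).
Proof.
move=> d0 q0 /andP[du uD] /andP[dv vD] q2 K a.
have D0 : 0 < D by lra.
have u0 : 0 < u by lra.
have v0 : 0 < v by lra.
have s2q := double_sqrt_le_add (ltW q0) (ltW u0) (ltW v0) q2.
have dq : d <= q.
  rewrite -(ler_pXn2r (ltn0Sn 1)) ?nnegrE ?(ltW q0) ?(ltW d0) ?(ltW D0) //.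
  by rewrite q2 expr2 ler_pM ?(ltW d0) ?(ltW u0) ?(ltW v0).
have qD : q <= D.
  rewrite -(ler_pXn2r (ltn0Sn 1)) ?nnegrE ?(ltW q0) ?(ltW d0) ?(ltW D0) //.
  by rewrite q2 expr2 ler_pM ?(ltW d0) ?(ltW u0) ?(ltW v0).
set s := u + v in s2q *.
have s0 : 0 < s by rewrite addr_gt0.
(* [L] is the left-hand side at [u = v = d], and [K = L * (d + D) ^+ 2 / (4 * d * D)]. The
   intermediate bound [L * (s / (2 * q))] separates two estimates: one on the ratio [s / (2 * q)],
   one on [q] alone up to the excess of [s] over [2 * q]. *)
pose L := (D ^+ 2 + d ^+ 2) / (D ^+ 2 * d ^+ 2).
have GA_ge : L * (s / (2 * q)) <= K * (2 * q / s).
  have -> : K * (2 * q / s) = L * (s / (2 * q)) +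
      (D ^+ 2 + d ^+ 2) * ((d + D) ^+ 2 * q ^+ 2 - s ^+ 2 * (d * D))
      / (2 * D ^+ 3 * d ^+ 3 * q * s).
    by rewrite /K /L; field; rewrite !gt_eqF.
  rewrite lerDl divr_ge0 //; last by rewrite !mulr_ge0 ?exprn_ge0 ?ltW.
  apply: mulr_ge0; first by rewrite addr_ge0 ?sqr_ge0.
  (* The ratio of two numbers in [[d, D]] lies between [d / D] and [D / d], which makes both factors
     nonnegative. *)
  have -> : (d + D) ^+ 2 * q ^+ 2 - s ^+ 2 * (d * D)
      = (u * D - v * d) * (v * D - u * d) by rewrite q2 /s; ring.
  by apply: mulr_ge0; rewrite subr_ge0 [_ * d]mulrC ler_pM // ltW.
(* The first summand of the numerator is linear in [s] and vanishes at [s = 2 * q]; the second is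
   what remains there, and it vanishes only at [q = d]. *)
have diffE : L * (s / (2 * q)) - (1 / q ^+ 2 + a * s) =
    ((s - 2 * q) * q * (D ^+ 2 + d ^+ 2 - q * d)
     + 2 * ((q - d) * (D ^+ 2 * q + d * (D ^+ 2 - q ^+ 2))))
    / (2 * D ^+ 2 * d ^+ 2 * q ^+ 2).
  by rewrite /L /a; field; rewrite !gt_eqF.
have den0 : 0 < 2 * D ^+ 2 * d ^+ 2 * q ^+ 2 by rewrite !mulr_gt0 ?exprn_gt0.
have t1 : 0 <= (s - 2 * q) * q * (D ^+ 2 + d ^+ 2 - q * d).
  by rewrite !mulr_ge0 ?(ltW q0) //; [lra | nra].
have c2 : 0 < D ^+ 2 * q + d * (D ^+ 2 - q ^+ 2).
  rewrite ltr_pwDl ?mulr_gt0 ?exprn_gt0 // mulr_ge0 ?(ltW d0) //.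
  by rewrite subr_ge0 lerXn2r // nnegrE ltW.
have t2 : 0 <= (q - d) * (D ^+ 2 * q + d * (D ^+ 2 - q ^+ 2)).
  by rewrite mulr_ge0 ?(ltW c2) // subr_ge0.
have mid : 1 / q ^+ 2 + a * s <= L * (s / (2 * q)).
  by rewrite -subr_ge0 diffE divr_ge0 ?(ltW den0) //; lra.
split; first exact: le_trans mid GA_ge.
move=> eqK; have /eqP : L * (s / (2 * q)) - (1 / q ^+ 2 + a * s) = 0 by lra.
rewrite diffE mulf_eq0 invr_eq0 (gt_eqF den0) orbF paddr_eq0 //; last by lra.
case/andP=> _; rewrite !mulf_eq0 (gt_eqF c2) orbF pnatr_eq0 /= => /eqP qd.
have {qd} qd : q = d by lra.
(* Two numbers that are at least [d] and have product [d ^+ 2] both equal [d]. *)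
move: q2; rewrite qd => q2; nra.
Qed.

End Inequalities.

(** * Summation over the edges and the equality cases *)

Theorem theorem2p12 (R : rcfType) (G : sgraph)
    (Gconn : connected G) (Gedge : edges G != set0) :
  let Delta : R := (max_deg G)%:R in
  let delta : R := (min_deg G)%:R in
  let M : R := (M1 G)%:R in
  let Rm1 : R := randic_m1 G R in
  let GA : R := GA1 G R in
  let lower : R :=
    4 * Delta ^+ 2 * delta ^+ 2 * Num.sqrt (2 * delta * M * Rm1)
      / ((Delta ^+ 2 + delta ^+ 2) * (delta + Delta) ^+ 2) in
  let upper : R := Num.sqrt (2 * Delta * M * Rm1) / 2 in
  [/\ lower <= GA, GA <= upper,
      lower = GA <-> regular G
    & GA = upper <-> regular G].
Proof.
move=> D d M Rm1 GA lower upper.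
pose q (e : {set G}) : R := Num.sqrt (deg_prod e)%:R.
pose s (e : {set G}) : R := (deg_sum e)%:R.
have d0 : 0 < d by rewrite ltr0n min_deg_gt0.
have dD (w : G) : d <= (deg w)%:R <= D.
  by rewrite !ler_nat geq_min_deg leq_max_deg.
have D0 : 0 < D.
  have [u _] := edge_exists Gedge; have /andP[] := dD u; lra.
have edgeE u v : sedge u v ->
    [/\ [set u; v] \in edges G, s [set u; v] = (deg u)%:R + (deg v)%:R,
        q [set u; v] ^+ 2 = (deg u)%:R * (deg v)%:R & 0 < q [set u; v]].
  move=> uv; have nuv := sedge_neq uv; split.
  - by apply/edgesP; exists u, v.
  - by rewrite /s deg_sum2 // natrD.
  - by rewrite sqr_sqrtr // deg_prod2 // natrM.
  - by rewrite sqrtr_gt0 ltr0n deg_prod2 // muln_gt0 !deg_gt0.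
have ME : M = \sum_(e in edges G) s e by rewrite /M M1_edges natr_sum.
have RE : Rm1 = \sum_(e in edges G) 1 / q e ^+ 2.
  by apply: eq_bigr => e _; rewrite sqr_sqrtr.
have GAE : GA = \sum_(e in edges G) 2 * q e / s e by [].
have M0 : 0 <= M by rewrite ler0n.
have R0 : 0 <= Rm1 by rewrite RE sumr_ge0 // => e _; rewrite divr_ge0 ?sqr_ge0.
have GA0 : 0 <= GA.
  by apply: sumr_ge0 => e _; rewrite !mulr_ge0 ?invr_ge0 ?sqrtr_ge0.
have up_edge e : e \in edges G ->
    (2 * q e / s e) ^+ 2 <= s e * (D / 2 / q e ^+ 2).
  case/edgesP => u [v [uv ->]]; have [_ -> q2 q0] := edgeE _ _ uv.
  have [||] // := GA_term_sqr_le (D := D) q0 _ _ q2; have := dD u; have := dD v;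
    lra.
have s_gt0 e : e \in edges G -> 0 < s e.
  case/edgesP => u [v [uv ->]]; have [_ -> _ _] := edgeE _ _ uv.
  have := dD u; have := dD v; lra.
have RDE : \sum_(e in edges G) D / 2 / q e ^+ 2 = D / 2 * Rm1.
  by rewrite RE mulr_sumr; apply: eq_bigr => e _; rewrite mul1r.
have [] := sqr_sum_le s_gt0 up_edge.
rewrite RDE -ME -GAE => GA_up GA_up_eq.
have X0 : 0 <= 2 * D * M * Rm1 by rewrite !mulr_ge0 // ltW.
have up0 : 0 <= upper by rewrite divr_ge0 ?sqrtr_ge0.
have upE : upper ^+ 2 = M * (D / 2 * Rm1).
  by rewrite expr_div_n sqr_sqrtr //; field.
pose K := (D ^+ 2 + d ^+ 2) * (d + D) ^+ 2 / (4 * D ^+ 3 * d ^+ 3).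
pose a := d / (2 * D ^+ 2 * d ^+ 2).
have K0 : 0 < K by rewrite divr_gt0 ?mulr_gt0 ?exprn_gt0 ?addr_gt0 ?exprn_gt0.
have a0 : 0 < a by rewrite divr_gt0 ?mulr_gt0 ?exprn_gt0.
(* Scaled by [K], the lower bound is the smaller side of AM-GM for [Rm1] and [a * M]; the square
   factor [(2 * D * d)^-1 ^+ 2] comes out of the root. *)
have lowE : K * lower = 2 * Num.sqrt (Rm1 * (a * M)).
  have -> : Rm1 * (a * M) = (2 * d * M * Rm1) * (2 * D * d)^-1 ^+ 2.
    by rewrite /a; field; rewrite !gt_eqF.
  rewrite sqrtrM; last by rewrite !mulr_ge0 // ltW.
  rewrite sqrtr_sqr ger0_norm; last first.
    by rewrite invr_ge0 !mulr_ge0 ?ltW.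
  rewrite /K /lower; field.
  by rewrite !gt_eqF ?addr_gt0 ?exprn_gt0.
(* Taking the equality itself as the condition lets [leif_sum] turn equality of the sums into
   equality at every edge. *)
have low_edge e : e \in edges G ->
    1 / q e ^+ 2 + a * s e <= K * (2 * q e / s e) ?= iff
    (1 / q e ^+ 2 + a * s e == K * (2 * q e / s e)).
  case/edgesP => u [v [uv ->]]; have [_ -> q2 q0] := edgeE _ _ uv.
  have [le_low _] := GA_term_ge d0 q0 (dD u) (dD v) q2.
  by split.
have := leif_sum low_edge.
rewrite big_split /= -RE -!mulr_sumr -ME -GAE => -[low_le low_eq].
(* With all degrees equal to [D] and [N] edges, [GA = N], [M = 2 * D * N] and [Rm1 = N / D ^+ 2], so
   both square roots equal [2 * N]. *)
have reg_eq : regular G -> GA = upper /\ lower = GA.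
  case=> k degk; have [dk Dk] := regular_min_max_deg Gedge degk.
  have dDE : d = D by rewrite /d dk /D Dk.
  have degD (w : G) : (deg w)%:R = D by rewrite /D Dk degk.
  pose N : R := #|edges G|%:R.
  have N0 : 0 <= N by rewrite ler0n.
  have edgeD e : e \in edges G -> s e = 2 * D /\ q e = D.
    case/edgesP => u [v [uv ->]]; have [_ -> q2 q0] := edgeE _ _ uv.
    rewrite !degD -expr2 in q2 *; split; first by ring.
    by apply/eqP; rewrite -(eqrXn2 (ltn0Sn 1) (ltW q0) (ltW D0)) q2.
  have GAN : GA = N.
    rewrite GAE (eq_bigr (fun=> 1)) ?sumr_const // => e /edgeD[-> ->].
    by rewrite divff // gt_eqF // mulr_gt0.
  have MN : M = 2 * D * N.
    rewrite ME (eq_bigr (fun=> 2 * D)) => [|e /edgeD[]//].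
    by rewrite sumr_const /N mulr_natr.
  have RN : Rm1 = D ^- 2 * N.
    rewrite RE (eq_bigr (fun=> D ^- 2)) => [|e /edgeD[_ ->]]; last by rewrite div1r.
    by rewrite sumr_const /N mulr_natr.
  have sqE : Num.sqrt (2 * D * M * Rm1) = 2 * N.
    rewrite MN RN (_ : _ * _ * _ * _ = (2 * N) ^+ 2); last by field; rewrite gt_eqF.
    by rewrite sqrtr_sqr ger0_norm // mulr_ge0.
  rewrite /lower /upper dDE sqE GAN; split; first by field.
  by field; rewrite -/D !gt_eqF ?addr_gt0 ?exprn_gt0.
have amgm := sqrt_mul2_le_add R0 (mulr_ge0 (ltW a0) M0).
rewrite -lowE in amgm.
have GA_low : lower <= GA by rewrite -(ler_pM2l K0) (le_trans amgm).
split=> //.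
- by rewrite -(ler_pXn2r (ltn0Sn 1)) ?nnegrE // upE.
- split=> [eq_low | /reg_eq[]//].
  (* The sum [Rm1 + a * M] is squeezed between [K * lower] and [K * GA], so equality holds at each
     edge and both its endpoints have degree [d]. *)
  have /eqP : Rm1 + a * M = K * GA.
    by apply/le_anti; rewrite low_le -eq_low amgm.
  rewrite low_eq => /forall_inP all_eq.
  apply: (regular_of_edges Gconn Gedge (k := min_deg G)) => u v uv.
  have [uvE sE q2 q0] := edgeE _ _ uv.
  have [_ eq_d] := GA_term_ge d0 q0 (dD u) (dD v) q2.
  have /eqP := all_eq _ uvE; rewrite sE => /eq_d /eqP.
  by rewrite eqr_nat => /eqP.
- split=> [eq_up | /reg_eq[]//].
  apply: (regular_of_edges Gconn Gedge (k := max_deg G)) => u v uv.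
  have [uvE sE q2 q0] := edgeE _ _ uv.
  have [||_ eq_D] := GA_term_sqr_le (D := D) q0 _ _ q2.
  + have := dD u; lra.
  + have := dD v; lra.
  (* Since [upper ^+ 2] is the Cauchy-Schwarz bound, [GA = upper] is its equality case, which passes
     to each edge. *)
  have := GA_up_eq _ _ uvE; rewrite sE eq_up upE => /(_ erefl)/eq_D /eqP.
  by rewrite eqr_nat => /eqP.
Qed.
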